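(* Let $I\subset(0,\infty)$ be an open interval, let $f:I\to\mathbb{R}$ be a smooth function, and let $u(q,t)=\tau-f(r)$, where $r=|q|$ and $\tau=|t|$. Then the horizontal mean curvature $\mathcal{H}^0$ of the hypersurface $S=\{(q,t)\in\mathfrak{H}_{\mathbb{H}} : r\in I,\ t\neq 0,\ \tau-f(r)=0\}$ is given at every point of $S$ by $$\mathcal{H}^0=\frac{-4r\,(2f'+rf'')-3\frac{(f')^3}{r}}{\left(4r^2+(f')^2\right)^{3/2}}+\frac{8r^2}{f\sqrt{4r^2+(f')^2}},$$ where $f,f',f''$ are evaluated at $r$, and $f'$, $f''$ denote the first and second derivatives of $f$ with respect to $r$.
   Context: Let $\mathbb{H}$ be the quaternions and $\mathrm{Im}\,\mathbb{H}$ the imaginary quaternions. The quaternionic Heisenberg group $\mathfrak{H}_{\mathbb{H}}$ is, as a manifold, $\mathbb{H}\times\mathrm{Im}\,\mathbb{H}\cong\mathbb{R}^7$, with coordinates $q=x_1+x_2\mathbf{i}+x_3\mathbf{j}+x_4\mathbf{k}$ and $t=t_1\mathbf{i}+t_2\mathbf{j}+t_3\mathbf{k}$; $|q|=(x_1^2+x_2^2+x_3^2+x_4^2)^{1/2}$ and $|t|=(t_1^2+t_2^2+t_3^2)^{1/2}$. The horizontal vector fields are $$\xi_1=\partial_{x_1}+2x_2\partial_{t_1}+2x_3\partial_{t_2}+2x_4\partial_{t_3},$$ $$\xi_2=\partial_{x_2}-2x_1\partial_{t_1}-2x_4\partial_{t_2}+2x_3\partial_{t_3},$$ $$\xi_3=\partial_{x_3}+2x_4\partial_{t_1}-2x_1\partial_{t_2}-2x_2\partial_{t_3},$$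 $$\xi_4=\partial_{x_4}-2x_3\partial_{t_1}+2x_2\partial_{t_2}-2x_1\partial_{t_3}.$$ For a regular hypersurface $S=\{u=0\}$ (with $u$ of class $C^2$), put $|\nabla_0u|=\left(\sum_{i=1}^4(\xi_iu)^2\right)^{1/2}$. The non-characteristic locus of $S$ is the set of points of $S$ where $|\nabla_0u|\ne0$. The horizontal mean curvature of $S$ is defined on the non-characteristic locus by $$\mathcal{H}^0=\sum_{i=1}^4\xi_i\left(\frac{\xi_iu}{|\nabla_0u|}\right).$$ *)

(* Defs.v *)
From Stdlib Require Import Reals.
From Coquelicot Require Import Coquelicot.
Open Scope R_scope.

Definition quaternion : Type := (R * R * R * R)%type.
Definition im_quaternion : Type := (R * R * R)%type.

(* The manifold H x Im H = R^7 underlying the quaternionic Heisenberg group;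
   ((x1, x2, x3, x4), (t1, t2, t3)) stands for
   q = x1 + x2 i + x3 j + x4 k and t = t1 i + t2 j + t3 k. *)
Definition heisenberg : Type := (quaternion * im_quaternion)%type.

Definition qnorm (q : quaternion) : R :=
  let '(x1, x2, x3, x4) := q in sqrt (x1 ^ 2 + x2 ^ 2 + x3 ^ 2 + x4 ^ 2).

Definition inorm (t : im_quaternion) : R :=
  let '(t1, t2, t3) := t in sqrt (t1 ^ 2 + t2 ^ 2 + t3 ^ 2).

Definition d_x1 (u : heisenberg -> R) (p : heisenberg) : R :=
  let '((x1, x2, x3, x4), t) := p in Derive (fun s => u ((s, x2, x3, x4), t)) x1.
Definition d_x2 (u : heisenberg -> R) (p : heisenberg) : R :=
  let '((x1, x2, x3, x4), t) := p in Derive (fun s => u ((x1, s, x3, x4), t)) x2.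
Definition d_x3 (u : heisenberg -> R) (p : heisenberg) : R :=
  let '((x1, x2, x3, x4), t) := p in Derive (fun s => u ((x1, x2, s, x4), t)) x3.
Definition d_x4 (u : heisenberg -> R) (p : heisenberg) : R :=
  let '((x1, x2, x3, x4), t) := p in Derive (fun s => u ((x1, x2, x3, s), t)) x4.
Definition d_t1 (u : heisenberg -> R) (p : heisenberg) : R :=
  let '(q, (t1, t2, t3)) := p in Derive (fun s => u (q, (s, t2, t3))) t1.
Definition d_t2 (u : heisenberg -> R) (p : heisenberg) : R :=
  let '(q, (t1, t2, t3)) := p in Derive (fun s => u (q, (t1, s, t3))) t2.
Definition d_t3 (u : heisenberg -> R) (p : heisenberg) : R :=
  let '(q, (t1, t2, t3)) := p in Derive (fun s => u (q, (t1, t2, s))) t3.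

Definition xi1 (u : heisenberg -> R) (p : heisenberg) : R :=
  let '((x1, x2, x3, x4), _) := p in
  d_x1 u p + 2 * x2 * d_t1 u p + 2 * x3 * d_t2 u p + 2 * x4 * d_t3 u p.
Definition xi2 (u : heisenberg -> R) (p : heisenberg) : R :=
  let '((x1, x2, x3, x4), _) := p in
  d_x2 u p - 2 * x1 * d_t1 u p - 2 * x4 * d_t2 u p + 2 * x3 * d_t3 u p.
Definition xi3 (u : heisenberg -> R) (p : heisenberg) : R :=
  let '((x1, x2, x3, x4), _) := p in
  d_x3 u p + 2 * x4 * d_t1 u p - 2 * x1 * d_t2 u p - 2 * x2 * d_t3 u p.
Definition xi4 (u : heisenberg -> R) (p : heisenberg) : R :=
  let '((x1, x2, x3, x4), _) := p in
  d_x4 u p - 2 * x3 * d_t1 u p + 2 * x2 * d_t2 u p - 2 * x1 * d_t3 u p.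

Definition hgrad_norm (u : heisenberg -> R) (p : heisenberg) : R :=
  sqrt (xi1 u p ^ 2 + xi2 u p ^ 2 + xi3 u p ^ 2 + xi4 u p ^ 2).

Definition noncharacteristic (u : heisenberg -> R) (p : heisenberg) : Prop :=
  hgrad_norm u p <> 0.

(* Meaningful only at noncharacteristic points: elsewhere the quotients are
   not the intended ones, since division is total. *)
Definition hmean_curvature (u : heisenberg -> R) (p : heisenberg) : R :=
    xi1 (fun p' => xi1 u p' / hgrad_norm u p') p
  + xi2 (fun p' => xi2 u p' / hgrad_norm u p') p
  + xi3 (fun p' => xi3 u p' / hgrad_norm u p') p
  + xi4 (fun p' => xi4 u p' / hgrad_norm u p') p.

Definition is_open_interval (I : R -> Prop) : Prop :=
  exists a b : Rbar, forall x : R, I x <-> Rbar_lt a x /\ Rbar_lt x b.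

(* For I open, the derivatives at points of I depend only on f restricted
   to I, so a total f stands for a function on I. *)
Definition smooth_on (I : R -> Prop) (f : R -> R) : Prop :=
  forall (n : nat) (x : R), I x -> ex_derive_n f n x.

Definition defining_function (f : R -> R) (p : heisenberg) : R :=
  inorm (snd p) - f (qnorm (fst p)).

Definition hypersurface (I : R -> Prop) (f : R -> R) (p : heisenberg) : Prop :=
  I (qnorm (fst p)) /\ snd p <> (0, 0, 0) /\ defining_function f p = 0.

(* Main.v *)
Require Import Defs.
From Stdlib Require Import Reals Lra.
From Coquelicot Require Import Coquelicot.
Open Scope R_scope.

(** Write r = |q|, tau = |t| and w = sqrt (4 r^2 + f'(r)^2).  Each horizontal
    field xi_i differentiates only one of the four coordinates of q, namely
    x = x_i, and the other three enter, permuted and with signs, as a vector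
    m of R^3: xi_i = d/dx + 2 (m . d/dt), with r^2 = x^2 + |m|^2.  So the four
    fields are instances of a single operator in the variables (x, t),
    [slice_field], and every derivative is computed once for all of them.

    Put a_i = m . t.  Then [horizontal_gradient] gives
    xi_i u = - f'(r) x_i / r + 2 a_i / tau.  The vector (a_i) is the
    quaternion - t q; hence it is orthogonal to q (because t is imaginary)
    and has length r tau.  Therefore
    |nabla_0 u| = w.  This depends on r alone and never vanishes for r > 0, so
    there are no characteristic points.

    Consequently the unit normal has components (xi_i u) / w on the open set
    where r lies in I and t <> 0, and since derivatives are local,
    [slice_field_normal] can differentiate this closed form, using
    d r / d x_i = x_i / r and |m|^2 = r^2 - x_i^2.  The result
    [normal_divergence_term] depends on i only through (x_i, a_i), as a
    polynomial of degree two in them.  Hence the sum over i is determined by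
    the three relations |x| = r, x . a = 0 and |a| = r tau
    ([normal_divergence_sum]), which gives

      - (f'' + 3 f' / r) / w + f' (4 r + f' f'') / w^3 + 8 r^2 / (tau w).

    Putting the first two terms over w^3 and using tau = f(r) on the surface
    yields the formula. *)

(** * One-dimensional slices of the horizontal fields *)

Definition slice_field (m1 m2 m3 : R) (F : R -> R -> R -> R -> R)
  (x t1 t2 t3 : R) : R :=
  Derive (fun s => F s t1 t2 t3) x
  + 2 * m1 * Derive (fun s => F x s t2 t3) t1
  + 2 * m2 * Derive (fun s => F x t1 s t3) t2
  + 2 * m3 * Derive (fun s => F x t1 t2 s) t3.

Lemma xi1_slice v x1 x2 x3 x4 t1 t2 t3 :
  xi1 v ((x1, x2, x3, x4), (t1, t2, t3))
  = slice_field x2 x3 x4 (fun s a b c => v ((s, x2, x3, x4), (a, b, c)))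
      x1 t1 t2 t3.
Proof.
unfold xi1, d_x1, d_t1, d_t2, d_t3, slice_field, quaternion, im_quaternion.
ring.
Qed.

Lemma xi2_slice v x1 x2 x3 x4 t1 t2 t3 :
  xi2 v ((x1, x2, x3, x4), (t1, t2, t3))
  = slice_field (- x1) (- x4) x3
      (fun s a b c => v ((x1, s, x3, x4), (a, b, c))) x2 t1 t2 t3.
Proof.
unfold xi2, d_x2, d_t1, d_t2, d_t3, slice_field, quaternion, im_quaternion.
ring.
Qed.

Lemma xi3_slice v x1 x2 x3 x4 t1 t2 t3 :
  xi3 v ((x1, x2, x3, x4), (t1, t2, t3))
  = slice_field x4 (- x1) (- x2)
      (fun s a b c => v ((x1, x2, s, x4), (a, b, c))) x3 t1 t2 t3.
Proof.
unfold xi3, d_x3, d_t1, d_t2, d_t3, slice_field, quaternion, im_quaternion.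
ring.
Qed.

Lemma xi4_slice v x1 x2 x3 x4 t1 t2 t3 :
  xi4 v ((x1, x2, x3, x4), (t1, t2, t3))
  = slice_field (- x3) x2 (- x1)
      (fun s a b c => v ((x1, x2, x3, s), (a, b, c))) x4 t1 t2 t3.
Proof.
unfold xi4, d_x4, d_t1, d_t2, d_t3, slice_field, quaternion, im_quaternion.
ring.
Qed.

Lemma slice_field_ext (m1 m2 m3 : R) (F G : R -> R -> R -> R -> R)
  (x t1 t2 t3 : R) :
  (forall s a b c, F s a b c = G s a b c) ->
  slice_field m1 m2 m3 F x t1 t2 t3 = slice_field m1 m2 m3 G x t1 t2 t3.
Proof.
intros HFG; unfold slice_field.
f_equal; [f_equal; [f_equal; [| f_equal] | f_equal] | f_equal];
  apply Derive_ext; intros s; apply HFG.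
Qed.

Lemma open_interval_locally (I : R -> Prop) (x : R) :
  is_open_interval I -> I x -> locally x I.
Proof.
intros [a [b HI]] Hx.
apply HI in Hx.
assert (Ho : open (fun y : R => Rbar_lt a y /\ Rbar_lt y b))
  by (apply open_and; [apply open_Rbar_gt | apply open_Rbar_lt]).
generalize (Ho x Hx); apply filter_imp.
intros y Hy; now apply HI.
Qed.

(** The closed forms of u and of its normal hold only where f is known to be
    smooth and t <> 0.  That region is open, and it therefore contains a
    neighbourhood of the point on each of the four coordinate lines along
    which the slice field differentiates. *)
Lemma slice_field_ext_loc (I : R -> Prop) (m1 m2 m3 M : R)
  (F G : R -> R -> R -> R -> R) (x t1 t2 t3 : R) :
  is_open_interval I ->
  (forall s a b c, I (sqrt (s ^ 2 + M)) -> 0 < a ^ 2 + b ^ 2 + c ^ 2 ->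
    F s a b c = G s a b c) ->
  I (sqrt (x ^ 2 + M)) -> 0 < t1 ^ 2 + t2 ^ 2 + t3 ^ 2 ->
  slice_field m1 m2 m3 F x t1 t2 t3 = slice_field m1 m2 m3 G x t1 t2 t3.
Proof.
intros HI HFG Hx Ht.
assert (pos_loc : forall (h : R -> R) (y : R),
          ex_derive h y -> 0 < h y -> locally y (fun s => 0 < h s)).
{ intros h y Hh Hy.
  apply (ex_derive_continuous h y Hh (fun z => 0 < z)).
  now apply (open_gt 0). }
unfold slice_field.
rewrite (Derive_ext_loc (fun s : R => F s t1 t2 t3)
  (fun s : R => G s t1 t2 t3) x).
2:{ assert (Hc : continuous (fun s => sqrt (s ^ 2 + M)) x).
    { apply (continuous_comp (fun s => s ^ 2 + M) sqrt).
      - apply (ex_derive_continuous (fun s => s ^ 2 + M)); auto_derive; easy.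
      - apply continuous_sqrt. }
    assert (Hn : locally x (fun s : R => I (sqrt (s ^ 2 + M))))
      by exact (Hc I (open_interval_locally I _ HI Hx)).
    revert Hn; apply filter_imp; intros s Hs; now apply HFG. }
rewrite (Derive_ext_loc (fun s : R => F x s t2 t3)
  (fun s : R => G x s t2 t3) t1).
2:{ generalize (pos_loc (fun s => s ^ 2 + t2 ^ 2 + t3 ^ 2) t1
                  ltac:(auto_derive; easy) Ht).
    apply filter_imp; intros s Hs; now apply HFG. }
rewrite (Derive_ext_loc (fun s : R => F x t1 s t3)
  (fun s : R => G x t1 s t3) t2).
2:{ generalize (pos_loc (fun s => t1 ^ 2 + s ^ 2 + t3 ^ 2) t2
                  ltac:(auto_derive; easy) Ht).
    apply filter_imp; intros s Hs; now apply HFG. }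
rewrite (Derive_ext_loc (fun s : R => F x t1 t2 s)
  (fun s : R => G x t1 t2 s) t3).
2:{ generalize (pos_loc (fun s => t1 ^ 2 + t2 ^ 2 + s ^ 2) t3
                  ltac:(auto_derive; easy) Ht).
    apply filter_imp; intros s Hs; now apply HFG. }
reflexivity.
Qed.

(** * The horizontal gradient *)

(* [auto_derive] unfolds squares, so the square roots which it returns are
   only convertible to the ones in the statements. *)
Ltac refold_sqrt r :=
  repeat match goal with
  | |- context [sqrt ?e] => progress change (sqrt e) with r
  end.

Lemma slice_field_defining (f : R -> R) (m1 m2 m3 M x t1 t2 t3 : R) :
  0 < x ^ 2 + M -> 0 < t1 ^ 2 + t2 ^ 2 + t3 ^ 2 ->
  ex_derive f (sqrt (x ^ 2 + M)) ->
  slice_field m1 m2 m3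
    (fun s a b c => sqrt (a ^ 2 + b ^ 2 + c ^ 2) - f (sqrt (s ^ 2 + M)))
    x t1 t2 t3
  = - Derive f (sqrt (x ^ 2 + M)) * x / sqrt (x ^ 2 + M)
    + 2 * (m1 * t1 + m2 * t2 + m3 * t3) / sqrt (t1 ^ 2 + t2 ^ 2 + t3 ^ 2).
Proof.
intros Hr Ht Hf; unfold slice_field.
assert (Hr' := sqrt_lt_R0 _ Hr).
assert (Ht' := sqrt_lt_R0 _ Ht).
set (r := sqrt (x ^ 2 + M)) in *.
set (tau := sqrt (t1 ^ 2 + t2 ^ 2 + t3 ^ 2)) in *.
replace (Derive _ x) with (- Derive f r * x / r).
2:{ symmetry; apply is_derive_unique; auto_derive.
    - refold_sqrt r; auto.
    - refold_sqrt r; change (fun y : R => f y) with f; field; lra. }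
replace (Derive _ t1) with (t1 / tau).
2:{ symmetry; apply is_derive_unique; auto_derive.
    - auto.
    - refold_sqrt tau; field; lra. }
replace (Derive _ t2) with (t2 / tau).
2:{ symmetry; apply is_derive_unique; auto_derive.
    - auto.
    - refold_sqrt tau; field; lra. }
replace (Derive _ t3) with (t3 / tau).
2:{ symmetry; apply is_derive_unique; auto_derive.
    - auto.
    - refold_sqrt tau; field; lra. }
field; lra.
Qed.

(** The slice field applied to one component of the unit normal, where g
    stands for f'.  The last summand is the contribution of the t-directions:
    2 m . grad_t (2 (m . t) / |t|) is
    4 (|m|^2 / tau - a^2 / tau^3), and |m|^2 = r^2 - x^2. *)
Lemma slice_field_normal (g : R -> R) (m1 m2 m3 x t1 t2 t3 : R) :
  let M := m1 ^ 2 + m2 ^ 2 + m3 ^ 2 in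
  let r := sqrt (x ^ 2 + M) in
  let tau := sqrt (t1 ^ 2 + t2 ^ 2 + t3 ^ 2) in
  let w := sqrt (4 * r ^ 2 + g r ^ 2) in
  let a := m1 * t1 + m2 * t2 + m3 * t3 in
  0 < x ^ 2 + M -> 0 < t1 ^ 2 + t2 ^ 2 + t3 ^ 2 -> ex_derive g r ->
  slice_field m1 m2 m3
    (fun s a b c =>
      (- g (sqrt (s ^ 2 + M)) * s / sqrt (s ^ 2 + M)
       + 2 * (m1 * a + m2 * b + m3 * c) / sqrt (a ^ 2 + b ^ 2 + c ^ 2))
      / sqrt (4 * sqrt (s ^ 2 + M) ^ 2 + g (sqrt (s ^ 2 + M)) ^ 2))
    x t1 t2 t3
  = - (Derive g r * x ^ 2 / r ^ 2 + g r * (1 / r - x ^ 2 / r ^ 3)) / w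
    - (- g r * x / r + 2 * a / tau) * (4 * r + g r * Derive g r) * (x / r)
      / w ^ 3
    + 4 * ((r ^ 2 - x ^ 2) / tau - a ^ 2 / tau ^ 3) / w.
Proof.
intros M r tau w a Hr Ht Hg; unfold slice_field.
assert (Hr' : 0 < r) by (apply sqrt_lt_R0; exact Hr).
assert (Ht' : 0 < tau) by (apply sqrt_lt_R0; exact Ht).
assert (Hw : 0 < 4 * r ^ 2 + g r ^ 2) by nra.
assert (Hw' : 0 < w) by (apply sqrt_lt_R0; exact Hw).
assert (Er : r ^ 2 - x ^ 2 = M) by (unfold r; rewrite pow2_sqrt; lra).
replace (Derive _ x) with
  (- (Derive g r * x ^ 2 / r ^ 2 + g r * (1 / r - x ^ 2 / r ^ 3)) / w
    - (- g r * x / r + 2 * a / tau) * (4 * r + g r * Derive g r) * (x / r)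
      / w ^ 3).
2:{ symmetry; apply is_derive_unique; fold a tau; auto_derive.
    - refold_sqrt r; refold_sqrt w;
      change (fun y : R => g y) with g; repeat split; auto; lra.
    - refold_sqrt r; refold_sqrt w;
      change (fun y : R => g y) with g; field; lra. }
fold r; fold w.
replace (Derive _ t1) with (2 * (m1 / tau - a * t1 / tau ^ 3) / w).
2:{ symmetry; apply is_derive_unique; auto_derive.
    - refold_sqrt tau; repeat split; auto; lra.
    - refold_sqrt tau; unfold a; field; lra. }
replace (Derive _ t2) with (2 * (m2 / tau - a * t2 / tau ^ 3) / w).
2:{ symmetry; apply is_derive_unique; auto_derive.
    - refold_sqrt tau; repeat split; auto; lra.
    - refold_sqrt tau; unfold a; field; lra. }
replace (Derive _ t3) with (2 * (m3 / tau - a * t3 / tau ^ 3) / w).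
2:{ symmetry; apply is_derive_unique; auto_derive.
    - refold_sqrt tau; repeat split; auto; lra.
    - refold_sqrt tau; unfold a; field; lra. }
rewrite Er; unfold M, a; field; lra.
Qed.

(** The length w of the horizontal gradient, as a function of the radius. *)
Definition radial_normal_length (f : R -> R) (r : R) : R :=
  sqrt (4 * r ^ 2 + Derive f r ^ 2).

(** The value of xi_i u when x = x_i and a = a_i, in a form which does not
    mention i. *)
Definition gradient_component (f : R -> R) (r tau x a : R) : R :=
  - Derive f r * x / r + 2 * a / tau.

(** In the square of the norm the cross terms cancel, because the vectors
    (x_i) and (a_i) are orthogonal, and |a|^2 = r^2 tau^2 turns the
    remaining part into 4 r^2. *)
Lemma horizontal_gradient (f : R -> R) (x1 x2 x3 x4 t1 t2 t3 : R) :
  let p := ((x1, x2, x3, x4), (t1, t2, t3)) in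
  let r := sqrt (x1 ^ 2 + x2 ^ 2 + x3 ^ 2 + x4 ^ 2) in
  let tau := sqrt (t1 ^ 2 + t2 ^ 2 + t3 ^ 2) in
  let u := defining_function f in
  0 < r -> 0 < tau -> ex_derive f r ->
  xi1 u p = gradient_component f r tau x1 (x2 * t1 + x3 * t2 + x4 * t3) /\
  xi2 u p = gradient_component f r tau x2 (- x1 * t1 + - x4 * t2 + x3 * t3) /\
  xi3 u p = gradient_component f r tau x3 (x4 * t1 + - x1 * t2 + - x2 * t3) /\
  xi4 u p = gradient_component f r tau x4 (- x3 * t1 + x2 * t2 + - x1 * t3) /\
  hgrad_norm u p = radial_normal_length f r.
Proof.
intros p r tau u Hr Ht Hf.
assert (Hr2 : 0 < x1 ^ 2 + x2 ^ 2 + x3 ^ 2 + x4 ^ 2).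
{ apply sqrt_lt_0_alt; rewrite sqrt_0; exact Hr. }
assert (Ht2 : 0 < t1 ^ 2 + t2 ^ 2 + t3 ^ 2).
{ apply sqrt_lt_0_alt; rewrite sqrt_0; exact Ht. }
assert (sl : forall m1 m2 m3 M x F,
  x ^ 2 + M = x1 ^ 2 + x2 ^ 2 + x3 ^ 2 + x4 ^ 2 ->
  (forall s a b c, F s a b c =
     sqrt (a ^ 2 + b ^ 2 + c ^ 2) - f (sqrt (s ^ 2 + M))) ->
  slice_field m1 m2 m3 F x t1 t2 t3
  = gradient_component f r tau x (m1 * t1 + m2 * t2 + m3 * t3)).
{ intros m1 m2 m3 M x F HM HF.
  transitivity (slice_field m1 m2 m3
    (fun s a b c => sqrt (a ^ 2 + b ^ 2 + c ^ 2) - f (sqrt (s ^ 2 + M)))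
    x t1 t2 t3).
  { now apply slice_field_ext. }
  assert (Hr' : sqrt (x ^ 2 + M) = r) by (unfold r; now rewrite HM).
  rewrite slice_field_defining; rewrite ?Hr', ?HM; trivial. }
assert (E1 : xi1 u p
  = gradient_component f r tau x1 (x2 * t1 + x3 * t2 + x4 * t3)).
{ unfold p; rewrite xi1_slice.
  apply (sl _ _ _ (x2 ^ 2 + x3 ^ 2 + x4 ^ 2)); [ring | intros].
  unfold u, defining_function; simpl; do 3 f_equal; ring. }
assert (E2 : xi2 u p
  = gradient_component f r tau x2 (- x1 * t1 + - x4 * t2 + x3 * t3)).
{ unfold p; rewrite xi2_slice.
  apply (sl _ _ _ (x1 ^ 2 + x3 ^ 2 + x4 ^ 2)); [ring | intros].
  unfold u, defining_function; simpl; do 3 f_equal; ring. }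
assert (E3 : xi3 u p
  = gradient_component f r tau x3 (x4 * t1 + - x1 * t2 + - x2 * t3)).
{ unfold p; rewrite xi3_slice.
  apply (sl _ _ _ (x1 ^ 2 + x2 ^ 2 + x4 ^ 2)); [ring | intros].
  unfold u, defining_function; simpl; do 3 f_equal; ring. }
assert (E4 : xi4 u p
  = gradient_component f r tau x4 (- x3 * t1 + x2 * t2 + - x1 * t3)).
{ unfold p; rewrite xi4_slice.
  apply (sl _ _ _ (x1 ^ 2 + x2 ^ 2 + x3 ^ 2)); [ring | intros].
  unfold u, defining_function; simpl; do 3 f_equal; ring. }
do 4 (split; [assumption |]).
unfold hgrad_norm, radial_normal_length; rewrite E1, E2, E3, E4; f_equal.
unfold gradient_component; set (d := Derive f r).
assert (Er : r ^ 2 = x1 ^ 2 + x2 ^ 2 + x3 ^ 2 + x4 ^ 2)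
  by (apply pow2_sqrt; lra).
assert (Et : tau ^ 2 = t1 ^ 2 + t2 ^ 2 + t3 ^ 2) by (apply pow2_sqrt; lra).
(* Euler's four-square identity with one vanishing component: |a|^2 is the
   product of the sums of squares of the x_i and of the t_k. *)
transitivity (d ^ 2 * (x1 ^ 2 + x2 ^ 2 + x3 ^ 2 + x4 ^ 2) / r ^ 2
  + 4 * ((x1 ^ 2 + x2 ^ 2 + x3 ^ 2 + x4 ^ 2) * (t1 ^ 2 + t2 ^ 2 + t3 ^ 2))
    / tau ^ 2).
- field; lra.
- rewrite <- Er, <- Et; field; lra.
Qed.

(** * The mean curvature *)

(** The value of xi_i ((xi_i u) / w) when x = x_i and a = a_i; the polynomial
    dependence on (x, a) is what makes the sum over i computable. *)
Definition normal_divergence_term (f : R -> R) (r tau x a : R) : R :=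
  let d := Derive f r in
  let dd := Derive (Derive f) r in
  let w := radial_normal_length f r in
  - (dd * x ^ 2 / r ^ 2 + d * (1 / r - x ^ 2 / r ^ 3)) / w
  - gradient_component f r tau x a * (4 * r + d * dd) * (x / r) / w ^ 3
  + 4 * ((r ^ 2 - x ^ 2) / tau - a ^ 2 / tau ^ 3) / w.

Lemma slice_field_normal_term (I : R -> Prop) (f : R -> R)
  (m1 m2 m3 x t1 t2 t3 : R) (F : R -> R -> R -> R -> R) :
  let M := m1 ^ 2 + m2 ^ 2 + m3 ^ 2 in
  let r := sqrt (x ^ 2 + M) in
  is_open_interval I -> (forall y, I y -> 0 < y) -> smooth_on I f ->
  I r -> 0 < t1 ^ 2 + t2 ^ 2 + t3 ^ 2 ->
  (forall s a b c, I (sqrt (s ^ 2 + M)) -> 0 < a ^ 2 + b ^ 2 + c ^ 2 ->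
    F s a b c
    = gradient_component f (sqrt (s ^ 2 + M)) (sqrt (a ^ 2 + b ^ 2 + c ^ 2)) s
        (m1 * a + m2 * b + m3 * c)
      / radial_normal_length f (sqrt (s ^ 2 + M))) ->
  slice_field m1 m2 m3 F x t1 t2 t3
  = normal_divergence_term f r (sqrt (t1 ^ 2 + t2 ^ 2 + t3 ^ 2)) x
      (m1 * t1 + m2 * t2 + m3 * t3).
Proof.
intros M r HI Hpos Hf Hr Ht HF.
rewrite (slice_field_ext_loc I _ _ _ M _ _ _ _ _ _ HI HF Hr Ht).
apply (slice_field_normal (Derive f) m1 m2 m3 x t1 t2 t3); trivial.
- apply sqrt_lt_0_alt; rewrite sqrt_0; now apply Hpos.
- exact (Hf 2%nat r Hr).
Qed.

Lemma hmean_curvature_terms (I : R -> Prop) (f : R -> R)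
  (x1 x2 x3 x4 t1 t2 t3 : R) :
  let p := ((x1, x2, x3, x4), (t1, t2, t3)) in
  let r := sqrt (x1 ^ 2 + x2 ^ 2 + x3 ^ 2 + x4 ^ 2) in
  let tau := sqrt (t1 ^ 2 + t2 ^ 2 + t3 ^ 2) in
  is_open_interval I -> (forall y, I y -> 0 < y) -> smooth_on I f ->
  I r -> 0 < t1 ^ 2 + t2 ^ 2 + t3 ^ 2 ->
  hmean_curvature (defining_function f) p
  = normal_divergence_term f r tau x1 (x2 * t1 + x3 * t2 + x4 * t3)
    + normal_divergence_term f r tau x2 (- x1 * t1 + - x4 * t2 + x3 * t3)
    + normal_divergence_term f r tau x3 (x4 * t1 + - x1 * t2 + - x2 * t3)
    + normal_divergence_term f r tau x4 (- x3 * t1 + x2 * t2 + - x1 * t3).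
Proof.
intros p r tau HI Hpos Hf Hr Ht.
assert (sl : forall m1 m2 m3 x F,
  x ^ 2 + (m1 ^ 2 + m2 ^ 2 + m3 ^ 2) = x1 ^ 2 + x2 ^ 2 + x3 ^ 2 + x4 ^ 2 ->
  (let M := m1 ^ 2 + m2 ^ 2 + m3 ^ 2 in
   forall s a b c, I (sqrt (s ^ 2 + M)) -> 0 < sqrt (s ^ 2 + M) ->
    0 < sqrt (a ^ 2 + b ^ 2 + c ^ 2) -> ex_derive f (sqrt (s ^ 2 + M)) ->
    F s a b c
    = gradient_component f (sqrt (s ^ 2 + M)) (sqrt (a ^ 2 + b ^ 2 + c ^ 2)) s
        (m1 * a + m2 * b + m3 * c)
      / radial_normal_length f (sqrt (s ^ 2 + M))) ->
  slice_field m1 m2 m3 F x t1 t2 t3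
  = normal_divergence_term f r tau x (m1 * t1 + m2 * t2 + m3 * t3)).
{ intros m1 m2 m3 x F HM HF.
  assert (Hr' : sqrt (x ^ 2 + (m1 ^ 2 + m2 ^ 2 + m3 ^ 2)) = r)
    by (unfold r; now rewrite HM).
  rewrite (slice_field_normal_term I f); rewrite ?Hr'; trivial.
  intros s a b c Hs Habc; apply HF; trivial.
  - now apply Hpos.
  - now apply sqrt_lt_R0.
  - exact (Hf 1%nat _ Hs). }
unfold hmean_curvature, p.
rewrite xi1_slice, xi2_slice, xi3_slice, xi4_slice.
f_equal; [f_equal; [f_equal |] |]; apply sl; try ring;
  intros M s a b c; unfold M.
- replace (s ^ 2 + (x2 ^ 2 + x3 ^ 2 + x4 ^ 2))
    with (s ^ 2 + x2 ^ 2 + x3 ^ 2 + x4 ^ 2) by ring.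
  intros _ Hs Habc Hfs.
  destruct (horizontal_gradient f s x2 x3 x4 a b c Hs Habc Hfs)
    as (E1 & _ & _ & _ & En).
  now rewrite E1, En.
- replace (s ^ 2 + ((- x1) ^ 2 + (- x4) ^ 2 + x3 ^ 2))
    with (x1 ^ 2 + s ^ 2 + x3 ^ 2 + x4 ^ 2) by ring.
  intros _ Hs Habc Hfs.
  destruct (horizontal_gradient f x1 s x3 x4 a b c Hs Habc Hfs)
    as (_ & E2 & _ & _ & En).
  now rewrite E2, En.
- replace (s ^ 2 + (x4 ^ 2 + (- x1) ^ 2 + (- x2) ^ 2))
    with (x1 ^ 2 + x2 ^ 2 + s ^ 2 + x4 ^ 2) by ring.
  intros _ Hs Habc Hfs.
  destruct (horizontal_gradient f x1 x2 s x4 a b c Hs Habc Hfs)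
    as (_ & _ & E3 & _ & En).
  now rewrite E3, En.
- replace (s ^ 2 + ((- x3) ^ 2 + x2 ^ 2 + (- x1) ^ 2))
    with (x1 ^ 2 + x2 ^ 2 + x3 ^ 2 + s ^ 2) by ring.
  intros _ Hs Habc Hfs.
  destruct (horizontal_gradient f x1 x2 x3 s a b c Hs Habc Hfs)
    as (_ & _ & _ & E4 & En).
  now rewrite E4, En.
Qed.

(** The terms are summed through the three quadratic invariants of the
    vectors (x_i) and (a_i); the individual coordinates disappear. *)
Lemma normal_divergence_sum (f : R -> R)
  (r tau x1 x2 x3 x4 a1 a2 a3 a4 : R) :
  let d := Derive f r in
  let dd := Derive (Derive f) r in
  let w := radial_normal_length f r in
  0 < r -> 0 < tau ->
  x1 ^ 2 + x2 ^ 2 + x3 ^ 2 + x4 ^ 2 = r ^ 2 ->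
  x1 * a1 + x2 * a2 + x3 * a3 + x4 * a4 = 0 ->
  a1 ^ 2 + a2 ^ 2 + a3 ^ 2 + a4 ^ 2 = r ^ 2 * tau ^ 2 ->
  normal_divergence_term f r tau x1 a1 + normal_divergence_term f r tau x2 a2
  + normal_divergence_term f r tau x3 a3 + normal_divergence_term f r tau x4 a4
  = (- 4 * r * (2 * d + r * dd) - 3 * (d ^ 3 / r)) / w ^ 3
    + 8 * r ^ 2 / (tau * w).
Proof.
intros d dd w Hr Ht Hx Hxa Ha.
unfold normal_divergence_term, gradient_component; fold d dd w.
assert (Hw2 : w ^ 2 = 4 * r ^ 2 + d ^ 2).
{ unfold w, radial_normal_length; fold d; apply pow2_sqrt; nra. }
assert (Hw : 0 < w) by (apply sqrt_lt_R0; fold d; nra).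
set (X := x1 ^ 2 + x2 ^ 2 + x3 ^ 2 + x4 ^ 2) in Hx.
set (Y := x1 * a1 + x2 * a2 + x3 * a3 + x4 * a4) in Hxa.
set (A := a1 ^ 2 + a2 ^ 2 + a3 ^ 2 + a4 ^ 2) in Ha.
transitivity (
  - (dd * X / r ^ 2 + d * (4 / r - X / r ^ 3)) / w
  - (- d * X / r + 2 * Y / tau) * (4 * r + d * dd) / r / w ^ 3
  + 4 * ((4 * r ^ 2 - X) / tau - A / tau ^ 3) / w).
- unfold X, Y, A; field; lra.
- rewrite Hx, Hxa, Ha.
  (* Over the common denominator w^3, the first quotient gains a factor w^2,
     which is the polynomial 4 r^2 + d^2. *)
  transitivity ((- (dd + 3 * d / r) * w ^ 2 + d * (4 * r + d * dd)) / w ^ 3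
    + 8 * r ^ 2 / (tau * w)).
  + field; lra.
  + rewrite Hw2; field; lra.
Qed.

Lemma Rpower_three_halves (y : R) : 0 < y -> Rpower y (3 / 2) = sqrt y ^ 3.
Proof.
intros Hy.
rewrite <- (Rpower_sqrt y Hy), <- Rpower_pow by apply exp_pos.
rewrite Rpower_mult; f_equal; simpl; field.
Qed.

Theorem theorem6p3 (I : R -> Prop) (f : R -> R)
  (I_interval : is_open_interval I)
  (I_pos : forall x : R, I x -> 0 < x)
  (f_smooth : smooth_on I f)
  (p : heisenberg) (p_S : hypersurface I f p) :
  let u := defining_function f in
  let r := qnorm (fst p) in
  let f' := Derive f r in
  let f'' := Derive_n f 2 r in
  noncharacteristic u p /\
  hmean_curvature u p =
    (- 4 * r * (2 * f' + r * f'') - 3 * (f' ^ 3 / r))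
      / Rpower (4 * r ^ 2 + f' ^ 2) (3 / 2)
    + 8 * r ^ 2 / (f r * sqrt (4 * r ^ 2 + f' ^ 2)).
Proof.
intros u r f' f''.
destruct p as [[[[x1 x2] x3] x4] [[t1 t2] t3]].
destruct p_S as (HI & Hne & Hu).
assert (Ht2 : 0 < t1 ^ 2 + t2 ^ 2 + t3 ^ 2).
{ destruct (Rtotal_order 0 (t1 ^ 2 + t2 ^ 2 + t3 ^ 2)) as [H | H]; trivial.
  exfalso; apply Hne; simpl snd.
  assert (t1 = 0) by nra; assert (t2 = 0) by nra; assert (t3 = 0) by nra.
  now subst. }
set (tau := sqrt (t1 ^ 2 + t2 ^ 2 + t3 ^ 2)).
assert (Ht : 0 < tau) by now apply sqrt_lt_R0.
assert (Hr : 0 < r) by now apply I_pos.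
assert (Hfr : f r = tau).
{ symmetry; apply Rminus_diag_uniq; exact Hu. }
assert (Hw2 : 0 < 4 * r ^ 2 + f' ^ 2) by nra.
split.
- destruct (horizontal_gradient f x1 x2 x3 x4 t1 t2 t3 Hr Ht
              (f_smooth 1%nat r HI)) as (_ & _ & _ & _ & En).
  intros H; apply (Rgt_not_eq _ _ (sqrt_lt_R0 _ Hw2)).
  exact (eq_trans (eq_sym En) H).
- rewrite (Rpower_three_halves _ Hw2), Hfr.
  etransitivity; [apply (hmean_curvature_terms I f); trivial |].
  assert (Er : r ^ 2 = x1 ^ 2 + x2 ^ 2 + x3 ^ 2 + x4 ^ 2)
    by (apply pow2_sqrt;
        generalize (pow2_ge_0 x1) (pow2_ge_0 x2) (pow2_ge_0 x3) (pow2_ge_0 x4);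
        lra).
  assert (Et : tau ^ 2 = t1 ^ 2 + t2 ^ 2 + t3 ^ 2) by (apply pow2_sqrt; lra).
  apply (normal_divergence_sum f r tau); trivial.
  + now rewrite Er.
  + ring.
  + rewrite Er, Et; ring.
Qed.
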